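(* Let $J\ge 2$ be an integer. For the optimal coefficients $\{c_\ell^J\}_{\ell=2}^J$ of the truncated trapezoidal rule of order $J$ (with the convention $c_3^J:=0$ if $J=2$), one has $$c_3^J = 3c_2^J-2+\frac{1-(-1)^J}{J+1}\,(1-c_2^J)(2-c_2^J).$$ In particular, $C_4^J=0$ if $J$ is even.
   Context: For an integer $J\ge 2$ and real coefficients $\{c_\ell^J\}_{\ell=2}^J\subset\mathbb{R}$, the truncated trapezoidal rule of order $J$ (TTR$_J$) is the linear multistep method with generating function $\delta_{\mathrm{TTR}_J}:\mathbb{C}\to\mathbb{C}$, $$\delta_{\mathrm{TTR}_J}(\zeta) = (1-\zeta)+\tfrac12(1-\zeta)^2+\sum_{\ell=2}^J 2^{-\ell}c_\ell^J(1-\zeta)^{\ell+1}.$$ The method is called A-stable if $\operatorname{Re}\bigl(\delta_{\mathrm{TTR}_J}(e^{\mathrm{i}\theta})\bigr)\ge 0$ for all $\theta\in[0,2\pi]$. The coefficients $\{c_\ell^J\}_{\ell=2}^J$ are called optimal if this A-stability condition is satisfied and $c_2^J$ is maximal among all real coefficient tuples $(c_2^J,\dots,c_J^J)$ for which the A-stability condition is satisfied. Write $\delta_{\mathrm{TTR}_J}(e^{\mathrm{i}\theta})=\sum_{k=1}^\infty \mathrm{i}^k C_k^J\theta^k$ with $C_k^J\in\mathbb{R}$. In particular $C_4^J=\frac14-\frac{3c_2^J}{8}+\frac{c_3^J}{8}$ (with $c_3^J=0$ if $J=2$). *)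

(* Defs.v *)
From mathcomp Require Export all_boot all_order all_algebra.
From mathcomp Require Export complex.
From mathcomp Require Export all_classical all_reals all_analysis.
Export Order.TTheory GRing.Theory Num.Theory.
Export numFieldNormedType.Exports.

Set Implicit Arguments.
Unset Strict Implicit.
Unset Printing Implicit Defensive.

Local Open Scope classical_set_scope.
Local Open Scope ring_scope.
Local Open Scope complex_scope.

(* A coefficient tuple (c_2, ..., c_J) is encoded as a function nat -> R of
   which only the values at 2, ..., J are ever used. *)
Definition delta_TTR (R : realType) (J : nat) (c : nat -> R) (z : R[i]) : R[i] :=
  (1 - z) + 2^-1 * (1 - z) ^+ 2
  + \sum_(2 <= l < J.+1) (2 ^- l * c l)%:C * (1 - z) ^+ l.+1.

Definition expi (R : realType) (t : R) : R[i] := cos t +i* sin t.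

Definition A_stable (R : realType) (delta : R[i] -> R[i]) : Prop :=
  forall t : R, 0 <= t <= 2 * pi -> 0 <= complex.Re (delta (expi t)).

Definition optimal_TTR (R : realType) (J : nat) (c : nat -> R) : Prop :=
  A_stable (delta_TTR J c) /\
  forall c' : nat -> R, A_stable (delta_TTR J c') -> c' 2%N <= c 2%N.

(* delta (e^{it}) = sum_{k >= 1} i^k C_k t^k with real C_k (C 0 is unused);
   the cast to R[i]^o selects the topology of the complex modulus. *)
Definition angular_expansion (R : realType) (delta : R[i] -> R[i])
    (C : nat -> R) : Prop :=
  forall t : R,
    (fun n : nat => \sum_(1 <= k < n) 'i%C ^+ k * (C k)%:C * t%:C ^+ k) @ \oo
      --> (delta (expi t) : R[i]^o).

(* Main.v *)
Require Import Defs.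
From mathcomp Require Import ring lra zify.

(** On the unit circle [(1 - z)^2 = - 2 y z] with [y = 1 - cos t], so every
power [(1 - z)^(l + 1)] with [l >= 3] is [4 y^2 z^2 (1 - z)^(l - 3)].  Hence
[Re (delta (e^{it})) = y^2 P (cos t)], where [P (cos t)] is the cosine sum
[sum_(k < J) B_k cos (k t)] with [B_0 = 1 - c_2 / 2], [B_1 = - c_2] and
otherwise arbitrary [B_k] ([Re_delta_TTR], [symbol_surj]).  A-stability says
that [P] is nonnegative on [[-1, 1]] ([A_stableP]), and maximizing [c_2] is
Fejer's problem of maximizing the ratio of the first two coefficients of a
nonnegative cosine sum.  The coefficient [c_3] is visible in
[P (1) = 1 - 3 c_2 / 2 + c_3 / 2] ([stability_poly1]); the theorem is thus the
computation of [P (1)].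

Let [N = J + 1], [C = cos (pi / N)], and let [t_j] be the [N] equispaced angles
[(2 j + 1) pi / N - pi].  Averaging over these angles is exact for cosine sums
of degree less than [N], which gives
[sum_j (C + cos t_j) P (cos t_j) = N (C B_0 + B_1 / 2)]
([sum_weighted_node]).  The weights [C + cos t_j] are nonnegative and vanish
only for the two angles nearest to [pi] and [- pi].  So the left-hand side is
nonnegative, and Fejer's polynomial shows that it can be zero
([fejer_extremal]).  For the optimal method it is therefore zero, which
determines [c_2] through [C (1 - c_2 / 2) = c_2 / 2] and forces [P] to vanish
at every [cos t_j] of nonzero weight ([optimal_interpolates]).

If [J] is even, the angle [0] is among the [t_j], and [P (1) = 0].

If [J] is odd, write [N = 2 n].  The remaining [n - 1] nodes are interior points
of [[-1, 1]], so the nonnegative polynomial [P] has double zeros there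
([double_roots]), and its degree leaves only a constant factor: [P = K Q^2] with
[Q] the product over these nodes.  As [Q] is, up to a constant, the
Chebyshev polynomial [T_n] divided by [X + C], the ratio of [P (1)] and
[P (- C)] follows from [T_n (1) = 1] and from the value of [T_n'] at [- C]
([nonneg_interpolation_ratio]), while the average of [P] over the angles gives
[P (- C) = n B_0].

Finally, for even [J] the factor [cos t - 1] of [P (cos t)] makes the real part
of [delta (e^{it})] of order [t^6], so the coefficients of its power series
below degree six vanish, among them [C_4] ([angular_coef4]). *)

Set Implicit Arguments.
Unset Strict Implicit.
Unset Printing Implicit Defensive.

Local Open Scope ring_scope.

(** * Chebyshev polynomials and cosine sums *)

Fixpoint cheb (R : realType) (k : nat) : {poly R} :=
  if k is k1.+1 then
    if k1 is k2.+1 then 'X *+ 2 * cheb R k1 - cheb R k2 else 'X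
  else 1.

Lemma chebSS (R : realType) k :
  cheb R k.+2 = 'X *+ 2 * cheb R k.+1 - cheb R k.
Proof. by []. Qed.

Lemma pair_ind (P : nat -> Prop) :
  P 0 -> P 1 -> (forall k, P k -> P k.+1 -> P k.+2) -> forall k, P k.
Proof.
move=> P0 P1 PS k; suff [] : P k /\ P k.+1 by [].
by elim: k => [|k [Pk Pk1]]; split=> //; apply: PS.
Qed.

Lemma cheb_cos (R : realType) k (t : R) : (cheb R k).[cos t] = cos (k%:R * t).
Proof.
elim/pair_ind: k => [||k IHk IHk1].
- by rewrite mul0r cos0 hornerE.
- by rewrite mul1r hornerE.
rewrite chebSS !hornerE IHk IHk1 -!natr1.
have -> : (k%:R + 1 + 1) * t = (k%:R + 1) * t + t by ring.
have -> : k%:R * t = (k%:R + 1) * t - t by ring.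
by rewrite (cosD _ t) (cosB _ t); ring.
Qed.

Lemma size_cheb (R : realType) k : (size (cheb R k) <= k.+1)%N.
Proof.
elim/pair_ind: k => [||k IHk IHk1].
- by rewrite size_poly1.
- by rewrite size_polyX.
rewrite chebSS (leq_trans (size_polyD _ _)) // geq_max size_polyN.
rewrite (leq_trans IHk) ?andbT; last by lia.
rewrite mulrnAl -scaler_nat (leq_trans (size_scale_leq _ _)) //.
by rewrite mulrC (leq_trans (size_mul_leq _ _)) // size_polyX addn2.
Qed.

(** Stated with the factor [1 - 'X^2], the derivative of [T_(k+1)] needs no
Chebyshev polynomials of the second kind, and the three-term recurrence proves
the identity by induction. *)
Lemma deriv_cheb (R : realType) k :
  (1 - 'X^2) * (cheb R k.+1)^`()
  = k.+1%:R * (cheb R k - 'X * cheb R k.+1).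
Proof.
elim/pair_ind: k => [||k IHk IHk1].
- by rewrite /= derivX; ring.
- by rewrite /= derivB derivM derivMn derivX -polyC1 derivC; ring.
rewrite chebSS derivB derivM derivMn derivX mulrBr.
have -> : (1 - 'X^2) * (1 *+ 2 * cheb R k.+2 + 'X *+ 2 * (cheb R k.+2)^`())
  = (1 - 'X^2) * 2%:R * cheb R k.+2
    + 'X *+ 2 * ((1 - 'X^2) * (cheb R k.+2)^`()) by ring.
rewrite IHk IHk1 !chebSS -!natr1; ring.
Qed.

Definition cheb_series (R : realType) n (B : nat -> R) : {poly R} :=
  \sum_(k < n) B k *: cheb R k.

Lemma cheb_series_cos (R : realType) n B (t : R) :
  (cheb_series n B).[cos t] = \sum_(k < n) B k * cos (k%:R * t).
Proof.
rewrite /cheb_series horner_sum; apply: eq_bigr => k _.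
by rewrite hornerZ cheb_cos.
Qed.

Lemma size_cheb_series (R : realType) n (B : nat -> R) :
  (size (cheb_series n B) <= n)%N.
Proof.
apply: leq_trans (size_sum _ _ _) _; apply/bigmax_leqP => k _.
exact: leq_trans (size_scale_leq _ _) (leq_trans (size_cheb _ _) (ltn_ord k)).
Qed.

(** Every point of [[-1, 1]] is the cosine of an angle in [[0, pi]], so the
sign of an algebraic polynomial can be read off from its cosine sum. *)
Lemma nonneg_of_cos (R : realType) (P : {poly R}) :
  (forall t, 0 <= t <= pi -> 0 <= P.[cos t]) ->
  forall x, -1 <= x <= 1 -> 0 <= P.[x].
Proof.
move=> P0 x x11; rewrite -(acosK (x := x)) ?in_itv //.
by apply: P0; rewrite acos_ge0 ?acos_lepi.
Qed.

(** * Double zeros of nonnegative polynomials *)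

(** Continuity, in the form used to recover a sign at a single point: at the
endpoint [1], where the factor [1 - cos t] vanishes, and at zeros that have
been divided out. *)
Lemma horner_ge0_punctured (R : realType) (P : {poly R}) (a d : R) :
  0 < d -> (forall x, a - d < x -> x < a -> 0 <= P.[x]) -> 0 <= P.[a].
Proof.
move=> d0 P0; rewrite leNgt; apply/negP => Pa.
have := @continuous_horner _ P a.
move=> /cvgrPdist_lt /(_ (- P.[a])); rewrite oppr_gt0 => /(_ Pa).
move=> /nbhs_ballP [e /= e0 He].
pose x := a - Num.min d e / 2.
have m0 : 0 < Num.min d e by rewrite lt_min d0.
have md : Num.min d e <= d by rewrite ge_min lexx.
have me : Num.min d e <= e by rewrite ge_min lexx orbT.
have : ball a e x by rewrite /ball /= /x opprB addrC subrK gtr0_norm; lra.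
move=> /He /= Hx; have : 0 <= P.[x] by apply: P0; rewrite /x; lra.
by move: Hx; rewrite ltr_norml => /andP[]; lra.
Qed.

(** At an interior zero [a] the quotient [P / (X - a)] is nonnegative on the
right of [a] and nonpositive on the left, hence zero at [a]; after dividing by
[(X - a)^2] the quotient is again nonnegative and still vanishes at the other
points. *)
Lemma double_roots (R : realType) (s : seq R) (P : {poly R}) :
  uniq s -> (forall a, a \in s -> -1 < a < 1 /\ P.[a] = 0) ->
  (forall x, -1 <= x <= 1 -> 0 <= P.[x]) ->
  exists K : {poly R}, P = K * (\prod_(a <- s) ('X - a%:P)) ^+ 2.
Proof.
elim: s P => [|a s IHs] P /=.
  by move=> _ _ _; exists P; rewrite big_nil expr1n mulr1.
move=> /andP[as_ us] Hs P0.
have [a11 Pa] := Hs a (mem_head _ _).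
have /factor_theorem [Q PQ] : root P a by apply/eqP.
have Qa : Q.[a] = 0.
  apply/eqP; rewrite eq_le; apply/andP; split.
    rewrite -oppr_ge0 -hornerN.
    apply: (@horner_ge0_punctured _ _ _ (a + 1)); first lra.
    move=> x xa ax; have := P0 x; rewrite PQ hornerM hornerXsubC => Px.
    have : 0 <= Q.[x] * (x - a) by apply: Px; lra.
    by rewrite hornerN oppr_ge0 nmulr_lge0 //; lra.
  (* Reflecting [Q] in the origin gives the same argument from the right of [a]. *)
  have -> : Q.[a] = (Q \Po (- 'X)).[- a] by rewrite horner_comp !hornerE opprK.
  apply: (@horner_ge0_punctured _ _ _ (1 - a)); first lra.
  move=> x xa ax; rewrite horner_comp hornerN hornerX.
  have := P0 (- x); rewrite PQ hornerM hornerXsubC => Px.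
  have : 0 <= Q.[- x] * (- x - a) by apply: Px; lra.
  by rewrite pmulr_lge0 //; lra.
have /factor_theorem [S QS] : root Q a by apply/eqP.
have PS : P = S * ('X - a%:P) ^+ 2 by rewrite PQ QS; ring.
have PSx x : P.[x] = S.[x] * (x - a) ^+ 2 by rewrite PS !hornerE.
have S0 x : x != a -> -1 <= x <= 1 -> 0 <= S.[x].
  move=> xa /P0; rewrite PSx pmulr_lge0 //.
  by rewrite exprn_even_gt0 //= subr_eq0.
have [||| K SK] := IHs S => //.
- move=> b bs; have [b11 Pb] := Hs b (mem_behead (s := a :: s) bs).
  split => //; move/eqP: Pb; rewrite PSx mulf_eq0 sqrf_eq0 subr_eq0.
  case: (eqVneq b a) => [ba|_]; first by rewrite -ba bs in as_.
  by rewrite orbF => /eqP.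
- move=> x x11; have [->|/S0->//] := eqVneq x a.
  apply: (@horner_ge0_punctured _ _ _ (a + 1)); first lra.
  by move=> y ya ay; apply: S0; [rewrite lt_eqF | lra].
by exists K; rewrite big_cons PS SK; ring.
Qed.

(** * Quadrature at equispaced angles *)

Lemma sin_natpi (R : realType) m : sin (m%:R * pi) = 0 :> R.
Proof.
elim: m => [|m IHm]; first by rewrite mul0r sin0.
by rewrite -natr1 mulrDl mul1r sinD IHm sinpi mul0r mulr0 addr0.
Qed.

Lemma sin_frac_gt0 (R : realType) N i : (0 < i < N)%N ->
  0 < sin (i%:R * (pi / N%:R) : R).
Proof.
move=> iN; have pi0 := pi_gt0 R.
have k1 : 0 < (i%:R / N%:R : R) < 1.
  by rewrite divr_gt0 ?ltr_pdivrMr ?ltr0n ?mul1r ?ltr_nat //; lia.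
by apply: sin_gt0_pi; rewrite mulrCA; nra.
Qed.

(** The [N] solutions of [(- e^{it})^N = - 1] in [[- pi, pi]]. The shift by
[pi] makes the first and the last angle the ones closest to [- pi] and [pi],
and puts [0] among the angles exactly when [N] is odd. *)
Definition node (R : realType) N j : R := j.*2.+1%:R * (pi / N%:R) - pi.

(** For [k > 0], multiplying [cos (k t_j)] by [2 sin (k pi / N)] turns the sum
into a telescoping one, whose two ends are sines of multiples of [pi]. *)
Lemma sum_cos_node (R : realType) N k : (k < N)%N ->
  \sum_(j < N) cos (k%:R * node R N j) = if k == 0%N then N%:R else 0.
Proof.
move=> kN; have N0 : N%:R != 0 :> R by rewrite pnatr_eq0; lia.
case: eqP => [->|/eqP k0].
  under eq_bigr do rewrite mul0r cos0.
  by rewrite sumr_const card_ord.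
have s0 : 0 < sin (k%:R * (pi / N%:R) : R).
  by apply: sin_frac_gt0; rewrite lt0n k0.
apply: (mulfI (lt0r_neq0 s0)); rewrite mulr0 mulr_sumr.
pose f j := sin (k%:R * (j.*2%:R * (pi / N%:R) - pi)) / 2 : R.
rewrite (eq_bigr (fun j : 'I_N => f j.+1 - f j)); last first.
  move=> j _; rewrite /f /node doubleS -[j.*2.+2%:R]natr1 -[j.*2.+1%:R]natr1.
  set d := pi / N%:R; set m := j.*2%:R.
  have -> : k%:R * ((m + 1 + 1) * d - pi)
    = k%:R * ((m + 1) * d - pi) + k%:R * d by ring.
  have -> : k%:R * (m * d - pi)
    = k%:R * ((m + 1) * d - pi) - k%:R * d by ring.
  by rewrite (sinD _ (k%:R * d)) (sinB _ (k%:R * d)); field.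
rewrite -(big_mkord xpredT (fun j => f j.+1 - f j)) telescope_sumr //.
rewrite /f double0 mul0r sub0r -mul2n natrM.
have -> : k%:R * (2 * N%:R * (pi / N%:R) - pi) = k%:R * pi :> R by field.
by rewrite mulrN sinN sin_natpi oppr0 mul0r subr0.
Qed.

Lemma sum_cheb_series_node (R : realType) N n (B : nat -> R) :
  (0 < n <= N)%N ->
  \sum_(j < N) (cheb_series n B).[cos (node R N j)] = N%:R * B 0%N.
Proof.
case: n => // n nN.
under eq_bigr do rewrite cheb_series_cos.
rewrite exchange_big /= big_ord_recl /= [X in _ + X]big1 => [|k _]; last first.
  rewrite -mulr_sumr sum_cos_node ?mulr0 //.
  by have := ltn_ord k; rewrite /bump /=; lia.
by rewrite -mulr_sumr (@sum_cos_node _ _ 0) ?addr0 1?mulrC //; lia.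
Qed.

(** The product of a cosine sum of degree less than [n] with [cos t] has degree
at most [n < N], so averaging over the nodes still extracts its constant
coefficient. *)
Lemma sum_weighted_node (R : realType) N n (B : nat -> R) (C : R) :
  (1 < n < N)%N ->
  \sum_(j < N) (C + cos (node R N j)) * (cheb_series n B).[cos (node R N j)]
  = N%:R * (C * B 0%N + B 1%N / 2).
Proof.
move=> nN.
under eq_bigr do rewrite mulrDl.
rewrite big_split /= -mulr_sumr sum_cheb_series_node; last lia.
under eq_bigr do rewrite cheb_series_cos mulr_sumr.
rewrite exchange_big /= mulrDr mulrCA; congr (_ + _).
case: n nN => [|[|n]] // nN; rewrite big_ord_recl big_ord_recl /=.
rewrite [X in _ + (_ + X)]big1.
  rewrite addr0.
  rewrite [X in X + _](_ : _ = 0) ?add0r; last first.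
    under eq_bigr do rewrite mul0r cos0 mulr1 mulrC -[X in cos X]mul1r.
    by rewrite -mulr_sumr (@sum_cos_node _ _ 1) ?mulr0 //; lia.
  rewrite (eq_bigr (fun j : 'I_N => B 1%N / 2 *
    (cos (2%:R * node R N j) + cos (0%:R * node R N j)))) => [|j _].
    rewrite -mulr_sumr big_split /= !sum_cos_node /=; [|lia..].
    by rewrite add0r mulrA mulrC mulrA.
  by rewrite mul0r cos0 (mulr_natl _ 2) cos_mulr2n mul1r; field.
move=> k _.
rewrite (eq_bigr (fun j : 'I_N => B k.+2 / 2 *
  (cos (k.+3%:R * node R N j) + cos (k.+1%:R * node R N j)))) => [|j _].
  have kn := ltn_ord k.
  rewrite -mulr_sumr big_split /= !sum_cos_node /=; [|lia..].
  by rewrite addr0 mulr0.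
rewrite /bump /= !add1n.
set x := node R N j.
have -> : k.+3%:R * x = k.+2%:R * x + x by rewrite -[k.+3%:R]natr1; ring.
have -> : k.+1%:R * x = k.+2%:R * x - x by rewrite -[k.+2%:R]natr1; ring.
by rewrite (cosD _ x) (cosB _ x); field.
Qed.

(** The product form shows both the sign of the quadrature weights and where
they vanish. *)
Lemma cos_nodeE (R : realType) N j :
  cos (pi / N%:R) + cos (node R N j)
  = 2 * (sin (j.+1%:R * (pi / N%:R)) * sin (j%:R * (pi / N%:R))).
Proof.
rewrite /node; set d := pi / N%:R.
have cp (x : R) : cos (x - pi) = - cos x.
  by rewrite cosB cospi sinpi mulrN1 mulr0 addr0.
have -> : d = j.+1%:R * d - j%:R * d by rewrite -[j.+1%:R]natr1; ring.
rewrite cp.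
have -> : j.*2.+1%:R * (j.+1%:R * d - j%:R * d) = j.+1%:R * d + j%:R * d.
  by rewrite -[j.*2.+1%:R]natr1 -[j.+1%:R]natr1 -mul2n natrM; ring.
rewrite cosB cosD.
have <- : d = j.+1%:R * d - j%:R * d by rewrite -[j.+1%:R]natr1; ring.
ring.
Qed.

Lemma cos_node_gt0 (R : realType) N j : (0 < j < N.-1)%N ->
  0 < cos (pi / N%:R) + cos (node R N j).
Proof.
by move=> jN; rewrite cos_nodeE !mulr_gt0 // sin_frac_gt0 //; lia.
Qed.

Lemma cos_node_ge0 (R : realType) N j : (j < N)%N ->
  0 <= cos (pi / N%:R) + cos (node R N j).
Proof.
move=> jN; have N0 : N%:R != 0 :> R by rewrite pnatr_eq0; lia.
have [->|j0] := posnP j; first by rewrite cos_nodeE mul0r sin0 !mulr0.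
have [jl|] := ltnP j N.-1; first by rewrite ltW // cos_node_gt0 // j0.
move=> jl; have -> : j = N.-1 by lia.
rewrite cos_nodeE prednK ?(leq_trans _ jN) // [N%:R * _]mulrCA mulfV //.
by rewrite mulr1 sinpi mul0r mulr0.
Qed.

(** * Fejer's extremal cosine polynomial *)

(** The polynomial [sum_i w_i z^i] is the one whose squared modulus on the unit
circle is extremal; its coefficients form an eigenvector of the path with [N -
1] vertices, extended by zero to the boundary indices [0] and [N]; the
alternating sign selects the smallest eigenvalue. *)
Definition fejer_weight (R : realType) N i : R :=
  (-1) ^+ i * sin (i%:R * (pi / N%:R)).

Lemma fejer_weight0 (R : realType) N : fejer_weight R N 0 = 0.
Proof. by rewrite /fejer_weight mul0r sin0 mulr0. Qed.

Lemma fejer_weightN (R : realType) N : (0 < N)%N -> fejer_weight R N N = 0.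
Proof.
move=> N0; rewrite /fejer_weight [N%:R * _]mulrCA mulfV ?mulr1 ?sinpi ?mulr0 //.
by rewrite pnatr_eq0; lia.
Qed.

Lemma fejer_weight_rec (R : realType) N i :
  fejer_weight R N i.+2 + fejer_weight R N i
  = - 2 * cos (pi / N%:R) * fejer_weight R N i.+1.
Proof.
rewrite /fejer_weight; set d := pi / N%:R.
have -> : i.+2%:R * d = i.+1%:R * d + d by rewrite -[i.+2%:R]natr1; ring.
have -> : i%:R * d = i.+1%:R * d - d by rewrite -[i.+1%:R]natr1; ring.
by rewrite (sinD _ d) (sinB _ d) !exprS; ring.
Qed.

(** The coefficients of the cosine sum [|sum_i w_(i+1) e^{it i}|^2]; the
truncated differences add up to the distance between the indices [i] and [j].
*)
Definition autocorr (R : realType) J (w : nat -> R) k : R :=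
  \sum_(i < J) \sum_(j < J) w i.+1 * w j.+1 * ((i - j + (j - i))%N == k)%:R.

Lemma autocorr_cos_ge0 (R : realType) J (w : nat -> R) (t : R) :
  0 <= \sum_(k < J) autocorr J w k * cos (k%:R * t).
Proof.
have -> : \sum_(k < J) autocorr J w k * cos (k%:R * t)
  = (\sum_(i < J) w i.+1 * cos (i%:R * t)) ^+ 2
  + (\sum_(i < J) w i.+1 * sin (i%:R * t)) ^+ 2; last first.
  by rewrite addr_ge0 ?sqr_ge0.
rewrite !expr2 !big_distrlr /= -big_split /=.
under eq_bigr do rewrite mulr_suml.
rewrite exchange_big /=; apply: eq_bigr => i _.
under eq_bigr do rewrite mulr_suml.
rewrite exchange_big /= -big_split /=; apply: eq_bigr => j _.
have iJ := ltn_ord i; have jJ := ltn_ord j.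
have dJ : (i - j + (j - i) < J)%N by lia.
rewrite (bigD1 (Ordinal dJ)) //= eqxx big1 => [|k /eqP kd]; last first.
  case: eqP => [E|]; last by rewrite mulr0 mul0r.
  by case: kd; apply: val_inj.
have -> : cos ((i - j + (j - i))%N%:R * t) = cos (i%:R * t - j%:R * t).
  have [ij|/ltnW ij] := leqP i j.
    rewrite (_ : (i - j + (j - i))%N = (j - i)%N); last lia.
    by rewrite natrB // mulrBl -cosN opprB.
  rewrite (_ : (i - j + (j - i))%N = (i - j)%N); last lia.
  by rewrite natrB // mulrBl.
by rewrite cosB /=; ring.
Qed.

(** Since the weights vanish at [0] and [J + 1], boundary indices need no
separate treatment when a neighbour of an index is selected. *)
Lemma fejer_weight_pick (R : realType) J k : (k <= J.+1)%N ->
  \sum_(j < J) fejer_weight R J.+1 j.+1 * (j.+1 == k)%:R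
  = fejer_weight R J.+1 k.
Proof.
case: k => [_|k kJ].
  by rewrite fejer_weight0 big1 // => j _; rewrite mulr0.
have [kJ'|] := ltnP k J.
  rewrite (bigD1 (Ordinal kJ')) //= eqxx mulr1 big1 ?addr0 // => j /eqP jk.
  by case: eqP => [[E]|]; rewrite ?mulr0 //; case: jk; apply: val_inj.
move=> Jk; have -> : k = J by lia.
rewrite fejer_weightN // big1 // => j _.
by rewrite eqSS ltn_eqF ?mulr0.
Qed.

(** The first coefficient pairs the weights with the sums of their neighbours,
which the eigenvector equation [fejer_weight_rec] turns back into the weights.
*)
Lemma autocorr_fejer (R : realType) J :
  cos (pi / J.+1%:R) * autocorr J (fejer_weight R J.+1) 0
  + autocorr J (fejer_weight R J.+1) 1 / 2 = 0.
Proof.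
set w := fejer_weight R J.+1; set C := cos _.
have -> : autocorr J w 0 = \sum_(i < J) w i.+1 * w i.+1.
  apply: eq_bigr => i _.
  have iJ : (i.+1 <= J.+1)%N by rewrite ltnS ltnW.
  rewrite -[X in _ = _ * X](fejer_weight_pick R iJ) mulr_sumr.
  apply: eq_bigr => j _; rewrite mulrA eqSS; congr (_ * (nat_of_bool _)%:R).
  by apply/eqP/eqP; lia.
have -> : autocorr J w 1 = \sum_(i < J) w i.+1 * (- 2 * C * w i.+1).
  apply: eq_bigr => i _; have iJ := ltn_ord i.
  have i2 : (i.+2 <= J.+1)%N by [].
  have i0 : (i <= J.+1)%N by lia.
  rewrite -fejer_weight_rec -(fejer_weight_pick R i2) -(fejer_weight_pick R i0).
  rewrite -big_split mulr_sumr /=.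
  apply: eq_bigr => j _; rewrite -mulrDr mulrA -natrD; congr (_ * _%:R).
  by case: eqP; case: eqP; case: eqP; lia.
rewrite [X in X / 2](_ : _ = - 2 * C * \sum_(i < J) w i.+1 * w i.+1).
  by field.
by rewrite mulr_sumr; apply: eq_bigr => i _; ring.
Qed.

Lemma autocorr0_gt0 (R : realType) J : (0 < J)%N ->
  0 < autocorr J (fejer_weight R J.+1) 0.
Proof.
case: J => // J _; rewrite /autocorr.
set w := fejer_weight R J.+2.
have -> : \sum_(i < J.+1) \sum_(j < J.+1)
    w i.+1 * w j.+1 * ((i - j + (j - i))%N == 0%N)%:R
  = \sum_(i < J.+1) w i.+1 ^+ 2.
  apply: eq_bigr => i _; rewrite (bigD1 i) //= subnn eqxx mulr1 -expr2.
  rewrite big1 ?addr0 // => j /eqP ji; case: eqP => [E|]; rewrite ?mulr0 //.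
  by case: ji; apply: val_inj => /=; lia.
rewrite big_ord_recl ltr_pwDl ?sumr_ge0 // => [|i _]; last exact: sqr_ge0.
by rewrite /w /fejer_weight exprMn sqrr_sign mul1r exprn_gt0 ?sin_frac_gt0.
Qed.

(** Scaling the squared modulus of the weighted sum so that its coefficients
satisfy [B_0 = 1 + B_1 / 2] places it among the polynomials of A-stable
methods; it attains equality in the bound that the quadrature gives. *)
Lemma fejer_extremal (R : realType) J : (1 < J)%N ->
  exists B : nat -> R, [/\ B 0%N = 1 + B 1%N / 2,
    cos (pi / J.+1%:R) * B 0%N + B 1%N / 2 = 0
    & forall x, -1 <= x <= 1 -> 0 <= (cheb_series J B).[x]].
Proof.
move=> J1; have a0 := @autocorr0_gt0 R J (ltnW J1).
have E := @autocorr_fejer R J.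
set A := autocorr J _ in a0 E; set C := cos _ in E *.
have C0 : 0 < C.
  have J3 : 2 < J.+1%:R :> R by rewrite ltr_nat.
  have p0 := pi_gt0 R.
  have d0 : 0 < (pi / J.+1%:R : R) by rewrite divr_gt0 ?ltr0n.
  apply: cos_gt0_pihalf; apply/andP; split.
    by rewrite (lt_trans _ d0) // oppr_lt0 divr_gt0.
  by rewrite ltr_pM2l // ltf_pV2 ?posrE ?ltr0n.
pose k := (A 0%N * (1 + C))^-1.
have k0 : 0 < k by rewrite invr_gt0 mulr_gt0 //; lra.
have kE : k * A 0%N * (1 + C) = 1.
  by rewrite /k -mulrA mulVf // lt0r_neq0 // mulr_gt0 //; lra.
exists (fun i => k * A i); split.
- have E1 : A 1%N / 2 = - (C * A 0%N) by lra.
  by rewrite -[k * A 1%N / 2]mulrA E1 -kE; ring.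
- by rewrite mulrCA -mulrA -mulrDr E mulr0.
apply: nonneg_of_cos => t _; rewrite cheb_series_cos.
under eq_bigr do rewrite -mulrA.
by rewrite -mulr_sumr mulr_ge0 ?autocorr_cos_ge0 // ltW.
Qed.

(** * Nonnegative polynomials vanishing at all nodes but the extreme ones *)

Lemma cheb_node (R : realType) n j : (0 < n)%N -> (j <= n)%N ->
  (cheb R n).[cos (node R n.*2 j)] = 0.
Proof.
move=> n0 jn; rewrite cheb_cos.
have -> : n%:R * node R n.*2 j = - ((n - j)%N%:R * pi) + pi / 2.
  rewrite /node natrB // -[j.*2.+1%:R]natr1 -!mul2n !natrM.
  by field; rewrite pnatr_eq0 -lt0n.
by rewrite cosDpihalf sinN sin_natpi oppr0 oppr0.
Qed.

Lemma node_itv (R : realType) n j : (j < n)%N ->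
  0 < - node R n.*2 j < pi.
Proof.
move=> jn; rewrite /node.
have k1 : 0 < (j.*2.+1%:R / n.*2%:R : R) < 1.
  by rewrite divr_gt0 ?ltr_pdivrMr ?ltr0n ?mul1r ?ltr_nat //; lia.
by have := pi_gt0 R; rewrite mulrCA; nra.
Qed.

Lemma cos_node_lt1 (R : realType) n j : (j < n)%N ->
  -1 < cos (node R n.*2 j) < 1.
Proof.
move=> jn; have /andP[x0 xpi] := node_itv R jn.
rewrite -cosN; apply/andP; split.
  by rewrite -[ltLHS]cospi ltr_cos ?in_itv /= ?lexx ?pi_ge0 ?(ltW x0) ?ltW.
by rewrite -[ltRHS]cos0 ltr_cos ?in_itv /= ?lexx ?pi_ge0 ?(ltW x0) ?ltW.
Qed.

Lemma cos_node_inj (R : realType) n :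
  {in [pred j | (j < n)%N] &, injective (fun j => cos (node R n.*2 j))}.
Proof.
move=> j k /= jn kn; rewrite !inE in jn kn *.
rewrite -cosN -[RHS]cosN => /cos_inj.
have /andP[/ltW x0 /ltW xpi] := node_itv R jn.
have /andP[/ltW y0 /ltW ypi] := node_itv R kn.
rewrite !in_itv /= x0 xpi y0 ypi => /(_ isT isT) /oppr_inj /addIr /mulIf.
have -> : pi / n.*2%:R != 0 :> R.
  by rewrite lt0r_neq0 // divr_gt0 ?pi_gt0 // ltr0n; lia.
by move=> /(_ isT) /eqP; rewrite eqr_nat => /eqP; lia.
Qed.

(** At a zero of [T_n] the formula [deriv_cheb] reduces to [(1 - x^2) T_n' (x)
= n T_(n-1) (x)], and there [T_(n-1)^2 = 1 - x^2]. *)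
Lemma deriv_cheb_node0 (R : realType) n : (0 < n)%N ->
  let x := cos (node R n.*2 0) in
  (1 - x ^+ 2) * (cheb R n)^`().[x] ^+ 2 = n%:R ^+ 2.
Proof.
case: n => // m _ x.
have Tn0 : (cheb R m.+1).[x] = 0 by rewrite cheb_node.
have := congr1 (horner^~ x) (deriv_cheb R m).
rewrite hornerM hornerD hornerN hornerXn -polyC1 hornerC -polyC_natr hornerM.
rewrite hornerC hornerD hornerN hornerM hornerX Tn0 mulr0 subr0 => D.
have x1 : 0 < 1 - x ^+ 2.
  have /andP[] := @cos_node_lt1 R m.+1 0 (ltn0Sn _).
  by rewrite -/x; nra.
set t := node R m.+1.*2 0 in x Tn0 D x1 *.
have cn : cos (m.+1%:R * t) = 0 by rewrite -cheb_cos.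
have Tm : (cheb R m).[x] ^+ 2 = 1 - x ^+ 2.
  rewrite cheb_cos -sin2cos2 (_ : m%:R * t = m.+1%:R * t - t); last first.
    by rewrite -natr1; ring.
  rewrite cosB cn mul0r add0r exprMn (sin2cos2 (_ * t)) cn expr0n.
  by rewrite subr0 mul1r.
apply: (mulfI (lt0r_neq0 x1)).
by rewrite mulrA -expr2 -exprMn D exprMn Tm mulrC.
Qed.

(** The double zeros leave [P = K Q^2] with a constant [K], where [T_n = L (X -
x) Q]. Squaring [L (1 - x) Q (1) = T_n (1) = 1] and [L Q (x) = T_n' (x)]
eliminates [K] and [L]. *)
Lemma nonneg_interpolation_ratio (R : realType) n (P : {poly R}) :
  (0 < n)%N -> (size P < n.*2)%N ->
  (forall x, -1 <= x <= 1 -> 0 <= P.[x]) ->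
  (forall j, (0 < j < n)%N -> P.[cos (node R n.*2 j)] = 0) ->
  let x := cos (node R n.*2 0) in
  n%:R ^+ 2 * (1 - x) * P.[1] = (1 + x) * P.[x].
Proof.
move=> n0 sP P0 Pz x.
pose f j := cos (node R n.*2 j) : R.
pose s := [seq f j | j <- iota 1 n.-1].
have xs : x :: s = [seq f j | j <- iota 0 n] by rewrite -(prednK n0).
have uxs : uniq (x :: s).
  rewrite xs map_inj_in_uniq ?iota_uniq // => j k.
  by rewrite !mem_iota /= !add0n; exact: cos_node_inj.
have us : uniq s by case/andP: uxs.
have [a as_|//|K PK] := @double_roots R s P us.
  have /mapP[j] := as_; rewrite mem_iota => jn ->.
  have jn' : (0 < j < n)%N by lia.
  rewrite /f; split; last exact: Pz.
  by case/andP: jn' => _; exact: cos_node_lt1.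
set Q := \prod_(a <- s) ('X - a%:P) in PK.
have Qmon : Q \is monic by apply: monic_prod_XsubC.
have sQ : size Q = n by rewrite size_prod_XsubC size_map size_iota prednK.
(* Degree count: [P] has degree at most [2 n - 2], the degree of [Q^2]. *)
have KC : K = (K`_0)%:P.
  apply: size1_polyC; have [->|K0] := eqVneq K 0; first by rewrite size_poly0.
  have KQ : K * Q != 0 by rewrite mulf_neq0 // monic_neq0.
  by move: sP; rewrite PK expr2 mulrA !size_Mmonic // sQ; lia.
have [L TL] : exists L : R, cheb R n = L%:P * (('X - x%:P) * Q).
  have [||q Tq] := @uniq_roots_prod_XsubC R (cheb R n) (x :: s).
  - rewrite xs all_map; apply/allP => j; rewrite mem_iota => jn /=.
    by apply/eqP/cheb_node => //; lia.
  - by rewrite uniq_rootsE.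
  rewrite big_cons -/Q in Tq; exists q`_0; rewrite -size1_polyC //.
  have [->|q0] := eqVneq q 0; first by rewrite size_poly0.
  have := size_cheb R n; rewrite Tq size_Mmonic ?monicMl ?monicXsubC //.
  by rewrite size_monicM ?monicXsubC ?monic_neq0 // size_XsubC sQ; lia.
have T1 : L * ((1 - x) * Q.[1]) = 1.
  have := cheb_cos n (0 : R); rewrite mulr0 cos0 TL !hornerM hornerC.
  by rewrite hornerXsubC.
have := @deriv_cheb_node0 R n n0; rewrite -/x /= TL derivM derivC mul0r add0r.
rewrite derivM derivXsubC mul1r hornerM hornerC hornerD hornerM hornerXsubC.
rewrite subrr mul0r addr0 => <-.
rewrite PK KC !hornerM hornerC -/Q.
have -> : (1 - x ^+ 2) * (L * Q.[x]) ^+ 2 * (1 - x) * (K`_0 * (Q.[1] * Q.[1]))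
  = (1 + x) * (K`_0 * (Q.[x] * Q.[x])) * (L * ((1 - x) * Q.[1])) ^+ 2 by ring.
by rewrite T1 expr1n mulr1 hornerC.
Qed.

(** * From the generating function to a nonnegative polynomial *)

Local Open Scope complex_scope.

(** The polynomial [B] with [Re (delta z) = (1 - cos t)^2 Re (B z)] for [z =
e^{it}]: the terms of order [l >= 3] contribute [4 2^-l c_l z^2 (1 - z)^(l-3)]
to [B], and the others its first two coefficients. *)
Definition symbol (R : realType) J (c : nat -> R) : {poly R} :=
  (1 - c 2%N / 2)%:P - c 2%N *: 'X
  + 'X^2 * \sum_(3 <= l < J.+1) (4 * (2 ^- l * c l)) *: (1 - 'X) ^+ (l - 3).

Definition stability_poly (R : realType) J (c : nat -> R) : {poly R} :=
  cheb_series J (fun k => (symbol J c)`_k).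

Lemma size_symbol (R : realType) J (c : nat -> R) :
  (2 <= J)%N -> (size (symbol J c) <= J)%N.
Proof.
move=> J2; rewrite /symbol.
have size1X k : (size ((1 - 'X : {poly R}) ^+ k) <= k.+1)%N.
  apply: leq_trans (size_poly_exp_leq _ _) _; rewrite ltnS.
  by rewrite -size_polyN opprB -polyC1 size_XsubC /= mul1n.
apply: leq_trans (size_polyD _ _) _; rewrite geq_max; apply/andP; split.
  apply: leq_trans (size_polyD _ _) _; rewrite geq_max size_polyN.
  rewrite (leq_trans (size_polyC_leq1 _) (ltnW J2)) /=.
  by rewrite (leq_trans (size_scale_leq _ _)) // size_polyX.
have [J3|J3] := leqP J 2; first by rewrite big_geq // mulr0 size_poly0.
apply: leq_trans (size_mul_leq _ _) _; rewrite size_polyXn /=.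
set S := \sum_(_ <= _ < _) _.
suff : (size S <= J - 2)%N.
  by rewrite leq_subRL ?add2n // ltnW.
rewrite /S big_nat; apply: leq_trans (size_sum _ _ _) _.
apply/bigmax_leqP_seq => l _ lJ.
rewrite (leq_trans (size_scale_leq _ _)) // (leq_trans (size1X _)) //; lia.
Qed.

Lemma expiX (R : realType) (t : R) k : expi t ^+ k = expi (k%:R * t).
Proof.
elim: k => [|k IHk]; first by rewrite expr0 mul0r /expi cos0 sin0.
rewrite exprS IHk -natr1 mulrDl mul1r /expi addrC cosD sinD.
by apply/eqP; rewrite eq_complex /= ; apply/andP; split => //; rewrite addrC.
Qed.

Lemma Re_real_mul (R : realType) (a : R) (w : R[i]) :
  complex.Re (a%:C * w) = a * complex.Re w.
Proof. by case: w => x y /=; rewrite mul0r subr0. Qed.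

Lemma ReD (R : realType) (v w : R[i]) :
  complex.Re (v + w) = complex.Re v + complex.Re w.
Proof. by case: v w => [a b] [a' b']. Qed.

Lemma Re_sum (R : realType) (I : Type) (r : seq I) (p : pred I) (F : I -> R[i]) :
  complex.Re (\sum_(i <- r | p i) F i) = \sum_(i <- r | p i) complex.Re (F i).
Proof. exact: (big_morph _ (@ReD R)). Qed.

Lemma Re_horner_expi (R : realType) n (B : {poly R}) (t : R) :
  (size B <= n)%N ->
  complex.Re (map_poly (real_complex R) B).[expi t]
  = (cheb_series n (fun k => B`_k)).[cos t].
Proof.
move=> Bn; rewrite (@horner_coef_wide _ n); last first.
  by rewrite size_map_poly.
rewrite cheb_series_cos Re_sum; apply: eq_bigr => k _.
by rewrite coef_map expiX Re_real_mul.
Qed.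

Lemma one_sub_expi_sqr (R : realType) (t : R) :
  (1 - expi t) ^+ 2 = (- 2 * (1 - cos t))%:C * expi t.
Proof.
have h := sin2cos2 t.
rewrite /expi; apply/eqP; rewrite eq_complex expr2 /=; apply/andP.
split; apply/eqP; ring: h.
Qed.

(** Terms of order [l >= 3] are divisible by [(1 - z)^4 = 4 y^2 z^2], exactly
and not only in their real part; the three remaining terms are computed
directly. *)
Lemma Re_delta_TTR (R : realType) J (c : nat -> R) (t : R) : (2 <= J)%N ->
  complex.Re (delta_TTR J c (expi t))
  = (1 - cos t) ^+ 2 * (stability_poly J c).[cos t].
Proof.
move=> J2; rewrite /stability_poly -Re_horner_expi ?size_symbol //.
rewrite -Re_real_mul.
set z := expi t; set y := 1 - cos t.
have z2 : (1 - z) ^+ 2 = (- 2 * y)%:C * z by exact: one_sub_expi_sqr.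
have -> : delta_TTR J c z =
  ((1 - z) + 2^-1 * (1 - z) ^+ 2 + (2 ^- 2 * c 2%N)%:C * (1 - z) ^+ 3)
  + \sum_(3 <= l < J.+1) (2 ^- l * c l)%:C * (1 - z) ^+ l.+1.
  by rewrite /delta_TTR big_ltn // addrA.
have -> : \sum_(3 <= l < J.+1) (2 ^- l * c l)%:C * (1 - z) ^+ l.+1
  = (y ^+ 2)%:C * (map_poly (real_complex R) ('X^2 *
    \sum_(3 <= l < J.+1) (4 * (2 ^- l * c l)) *: (1 - 'X) ^+ (l - 3))).[z].
  rewrite [map_poly _ (_ * _)]rmorphM (rmorph_sum (map_poly (real_complex R))).
  rewrite /= map_polyXn hornerM hornerXn horner_sum.
  rewrite mulrA mulr_sumr !big_nat; apply: eq_bigr => l /andP[l3 _].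
  rewrite map_polyZ hornerZ (rmorphXn (map_poly (real_complex R))) /=.
  rewrite (rmorphB (map_poly (real_complex R))) /= map_polyX rmorph1.
  rewrite horner_exp hornerD hornerN hornerX -polyC1 hornerC.
  rewrite [in LHS](_ : l.+1 = l - 3 + 4)%N ?exprD; last lia.
  have -> : (1 - z) ^+ 4 = (y ^+ 2)%:C * (4%:C * z ^+ 2).
    rewrite (exprM (1 - z) 2 2) z2 exprMn mulrA -!rmorphXn -rmorphM /=.
    by congr (_%:C * _); ring.
  by rewrite rmorphM; ring.
have Re_low : complex.Re
    ((1 - z) + 2^-1 * (1 - z) ^+ 2 + (2 ^- 2 * c 2%N)%:C * (1 - z) ^+ 3)
  = y ^+ 2 * (1 - c 2%N / 2 - c 2%N * cos t).
  have -> : (2^-1 : R[i]) = (2^-1)%:C by rewrite fmorphV rmorph_nat.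
  have -> : (1 - z) ^+ 3 = (- 2 * y)%:C * (z * (1 - z)).
    by rewrite exprSr z2 mulrA.
  rewrite z2 !ReD !Re_real_mul /z /expi /= /y.
  by have h := sin2cos2 t; field: h.
set low := _ + _ + _ in Re_low *; set high := (y ^+ 2)%:C * _.
rewrite (ReD low high) Re_low /high !Re_real_mul -mulrDr; congr (_ * _).
rewrite /symbol (rmorphD (map_poly (real_complex R))) hornerD.
set p := (X in X.[z] + _); set q := (X in _ + X.[z]).
rewrite (ReD p.[z] q.[z]); congr (_ + _).
have -> : p.[z] = (1 - c 2%N / 2)%:C - (c 2%N)%:C * z.
  rewrite /p (rmorphB (map_poly (real_complex R))) /= hornerD hornerN.
  by rewrite map_polyC map_polyZ map_polyX hornerZ hornerC hornerX.
by rewrite /= mul0r subr0.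
Qed.

(** The factor [(1 - cos t)^2] hides the sign of the polynomial at [1] only,
where it is recovered by continuity. *)
Lemma A_stableP (R : realType) J (c : nat -> R) : (2 <= J)%N ->
  A_stable (delta_TTR J c) <->
  forall x, -1 <= x <= 1 -> 0 <= (stability_poly J c).[x].
Proof.
move=> J2; split => [stab x x11|P0 t _]; last first.
  by rewrite Re_delta_TTR // mulr_ge0 ?sqr_ge0 ?P0 // cos_geN1 cos_le1.
have P0 y : -1 <= y < 1 -> 0 <= (stability_poly J c).[y].
  move=> /andP[y1 y2]; have y11 : -1 <= y <= 1 by rewrite y1 ltW.
  have := stab (acos y); rewrite Re_delta_TTR // acosK ?in_itv //.
  rewrite pmulr_rge0; last by rewrite exprn_gt0 // subr_gt0.
  apply; rewrite acos_ge0 //= (le_trans (acos_lepi y11)) //.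
  by have := pi_gt0 R; lra.
have [->|x1] := eqVneq x 1; last by apply: P0; lra.
by apply: (@horner_ge0_punctured _ _ _ 2) => // y y1 y2; apply: P0; lra.
Qed.

Lemma symbol0 (R : realType) J (c : nat -> R) :
  (symbol J c)`_0 = 1 - c 2%N / 2.
Proof.
by rewrite /symbol coefD coefB coefC coefZ coefX coefXnM /= mulr0 subr0 addr0.
Qed.

Lemma symbol1 (R : realType) J (c : nat -> R) : (symbol J c)`_1 = - c 2%N.
Proof.
by rewrite /symbol coefD coefB coefC coefZ coefX coefXnM /= mulr1 sub0r addr0.
Qed.

(** The part of degree at least two of the symbol is [X^2 G] with [G] written
in powers of [1 - X], and substituting [1 - X] for [X] is an involution: the
coefficients of [G \Po (1 - 'X)] give the method. *)
Lemma symbol_surj (R : realType) J (B : nat -> R) : (2 <= J)%N ->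
  B 0%N = 1 + B 1%N / 2 ->
  exists2 c, c 2%N = - B 1%N & stability_poly J c = cheb_series J B.
Proof.
move=> J2 B0.
pose G := \poly_(k < J - 2) B k.+2.
pose H := G \Po (1 - 'X).
pose c l := if l == 2 then - B 1%N else H`_(l - 3) * 2 ^+ l / 4.
exists c => //; rewrite /stability_poly /cheb_series; apply: eq_bigr => k _.
congr (_ *: _); case: k => [[|[|k]]] /= kJ.
- by rewrite symbol0 /c /= B0 mulNr opprK.
- by rewrite symbol1 opprK.
rewrite /symbol coefD coefB coefC coefZ coefX coefXnM /= mulr0 subr0 add0r.
rewrite subn2 /=.
suff -> : \sum_(3 <= l < J.+1) (4 * (2 ^- l * c l)) *: (1 - 'X) ^+ (l - 3) = G.
  by rewrite coef_poly ifT //; lia.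
have size1X : size (1 - 'X : {poly R}) = 2%N.
  by rewrite -size_polyN opprB -polyC1 size_XsubC.
have HJ : (size H <= J - 2)%N.
  by rewrite size_comp_poly2 ?size1X // size_poly.
have -> : G = H \Po (1 - 'X).
  by rewrite /H -comp_polyA comp_polyB comp_polyX -polyC1 comp_polyC opprB
    addrC subrK comp_polyXr.
have -> : H = \sum_(0 <= i < J - 2) H`_i *: 'X^i.
  rewrite big_mkord; apply/polyP => i; rewrite -[in LHS](coefK H) coef_poly.
  rewrite -poly_def coef_poly; case: ltnP => iH; case: ltnP => iJ //; try lia.
  by rewrite nth_default.
rewrite -[3%N]add0n big_addn raddf_sum (_ : (J.+1 - 3)%N = (J - 2)%N); last lia.
apply: eq_bigr => i _; rewrite /= addnK linearZ /= rmorphXn /= comp_polyX.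
congr (_ *: _); rewrite /c ifF ?addnK; last by apply/eqP; lia.
by field; rewrite expf_neq0 // pnatr_eq0.
Qed.

Lemma stability_poly1 (R : realType) J (c : nat -> R) : (2 <= J)%N ->
  (stability_poly J c).[1]
  = 1 - 3 / 2 * c 2%N + (if J == 2%N then 0 else c 3%N) / 2.
Proof.
move=> J2; rewrite -[X in _.[X]]cos0 cheb_series_cos.
rewrite (eq_bigr (fun k : 'I_J => (symbol J c)`_k * 1 ^+ k)) => [|k _]; last first.
  by rewrite mulr0 cos0 expr1n.
rewrite -(horner_coef_wide _ (size_symbol c J2)) /symbol.
rewrite hornerD hornerD hornerN hornerC hornerZ hornerX hornerM hornerXn.
rewrite expr1n mul1r horner_sum.
case: eqP => [->|/eqP J3]; first by rewrite big_geq //; field.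
rewrite big_ltn; last lia.
rewrite subnn expr0 hornerZ -polyC1 hornerC big_nat_cond big1 => [|l lJ].
  by rewrite !exprS expr0; field.
rewrite hornerZ horner_exp hornerD hornerN hornerC hornerX subrr expr0n.
by rewrite (_ : (l - 3 == 0)%N = false) ?mulr0 //; lia.
Qed.

(** * The optimal coefficients *)

(** The quadrature sum has nonnegative terms. Comparison with the method of
Fejer's polynomial bounds its value by zero, so each term vanishes. *)
Lemma optimal_interpolates (R : realType) J (c : nat -> R) :
  (2 <= J)%N -> optimal_TTR J c ->
  let C := cos (pi / J.+1%:R) in
  C * (1 - c 2%N / 2) = c 2%N / 2 /\
  forall j, (0 < j < J)%N -> (stability_poly J c).[cos (node R J.+1 j)] = 0.
Proof.
move=> J2 [stab opt] C.
set P := stability_poly J c.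
have P0 : forall x, -1 <= x <= 1 -> 0 <= P.[x] by apply/A_stableP.
have term0 (j : 'I_J.+1) :
    0 <= (C + cos (node R J.+1 j)) * P.[cos (node R J.+1 j)].
  by rewrite mulr_ge0 ?cos_node_ge0 // P0 // cos_geN1 cos_le1.
have J1J : (1 < J < J.+1)%N by rewrite J2 /=.
have sumP := sum_weighted_node (fun k => (symbol J c)`_k) C J1J.
rewrite -/(stability_poly J c) -/P symbol0 symbol1 in sumP.
have [B [B0 BC Bpos]] := fejer_extremal R J2.
have [c' c'2 c'P] := symbol_surj J2 B0.
have c'c : - B 1%N <= c 2%N.
  by rewrite -c'2; apply: opt; apply/A_stableP => //; rewrite c'P.
have sum_ge0 : 0 <= \sum_(j < J.+1)
    (C + cos (node R J.+1 j)) * P.[cos (node R J.+1 j)] by apply: sumr_ge0.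
have C0 : -1 <= C by exact: cos_geN1.
have sum_eq0 : C * (1 - c 2%N / 2) + - c 2%N / 2 = 0.
  apply/eqP; rewrite eq_le; apply/andP; split.
    by rewrite -/C B0 in BC; nra.
  by move: sum_ge0; rewrite sumP pmulr_rge0 // ltr0n.
split; first by lra.
move=> j /andP[j0 jJ].
move/eqP: sumP; rewrite sum_eq0 mulr0 psumr_eq0 => [/allP /= all0|? _ //].
have jJ1 : (j < J.+1)%N by rewrite ltnS ltnW.
have /eqP := all0 (Ordinal jJ1) (mem_index_enum _); move/eqP.
rewrite mulf_eq0 /= => /orP[/eqP E|/eqP //].
have : 0 < C + cos (node R J.+1 j) by apply: cos_node_gt0; rewrite /= j0.
by rewrite E ltxx.
Qed.

Lemma even_optimal (R : realType) J (c : nat -> R) :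
  (2 <= J)%N -> optimal_TTR J c -> ~~ odd J -> (stability_poly J c).[1] = 0.
Proof.
move=> J2 opt Jeven.
have [_ /(_ J./2)] := optimal_interpolates J2 opt.
have JE : J./2.*2 = J by rewrite -[RHS]odd_double_half (negbTE Jeven).
have -> : node R J.+1 J./2 = 0.
  by rewrite /node JE mulrCA mulfV ?mulr1 ?subrr // pnatr_eq0.
by rewrite cos0; apply; lia.
Qed.

(** Among the nodes, only the first and the last carry a nonzero value of the
polynomial, and they have the same cosine; the mean value formula therefore
gives that value, and [nonneg_interpolation_ratio] transports it to [1]. *)
Lemma odd_optimal (R : realType) J (c : nat -> R) :
  (2 <= J)%N -> optimal_TTR J c -> odd J ->
  (stability_poly J c).[1] * J.+1%:R = (1 - c 2%N) * (2 - c 2%N).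
Proof.
move=> J2 opt Jodd.
have [cC Pz] := optimal_interpolates J2 opt.
have P0 := (A_stableP c J2).1 opt.1.
set P := stability_poly J c in Pz P0 *; set C := cos _ in cC.
pose n := J./2.+1.
have nJ : n.*2 = J.+1 by rewrite -[in RHS](odd_double_half J) Jodd.
have sP : (size P < n.*2)%N by rewrite nJ ltnS size_cheb_series.
have Jn j : (0 < j < n)%N -> (0 < j < J)%N by lia.
have xC : cos (node R n.*2 0) = - C.
  by rewrite /node nJ mul1r cosB cospi sinpi mulrN1 mulr0 addr0.
have ratio : n%:R ^+ 2 * (1 + C) * P.[1] = (1 - C) * P.[- C].
  have := @nonneg_interpolation_ratio R n P isT sP P0 _.
  by rewrite /= xC opprK; apply => j jn; rewrite nJ; apply/Pz/Jn.
(* The last node is the opposite of the first one. *)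
have xJ : cos (node R J.+1 J) = - C.
  rewrite -xC -[RHS]cosN nJ /node; congr cos.
  rewrite -[J.*2.+1%:R]natr1 -[J.*2]mul2n natrM double0 -[J.+1%:R]natr1.
  by field; rewrite natr1 pnatr_eq0.
have JJ : (0 < J <= J.+1)%N by rewrite leqnSn ltnW.
have := sum_cheb_series_node (fun k => (symbol J c)`_k) JJ.
rewrite -/(stability_poly J c) -/P symbol0.
rewrite -(big_mkord xpredT (fun j => P.[cos (node R J.+1 j)])).
rewrite big_nat_recr //= big_ltn ?(ltnW J2) //.
rewrite big_nat big1 => [|j]; last exact: Pz.
rewrite xJ -nJ xC addr0 -mul2n natrM => sumP.
have n_neq0 : n%:R != 0 :> R by rewrite pnatr_eq0.
have PC : P.[- C] = n%:R * (1 - c 2%N / 2) by lra.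
have {}ratio : n%:R * ((1 + C) * P.[1]) = 1 - c 2%N.
  apply: (mulfI n_neq0).
  have -> : n%:R * (n%:R * ((1 + C) * P.[1])) = n%:R ^+ 2 * (1 + C) * P.[1].
    by ring.
  by rewrite ratio PC mulrCA; congr (_ * _); lra.
have C1 : (1 + C) * (1 - c 2%N / 2) = 1 by lra.
rewrite -ratio.
have -> : 2 - c 2%N = 2 * (1 - c 2%N / 2) by field.
have -> : n%:R * ((1 + C) * P.[1]) * (2 * (1 - c 2%N / 2))
  = P.[1] * (2 * n%:R) * ((1 + C) * (1 - c 2%N / 2)) by ring.
by rewrite C1 mulr1.
Qed.

(** * The fourth coefficient of the angular expansion *)

Local Open Scope classical_set_scope.

(** Once the coefficients below [j] are known to vanish, the bounded tail gives
[|a_j| t^j <= K t^m + 2 M t^(j+1)] for small [t], and dividing by [t^j] shows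
[a_j = 0]. *)
Lemma power_series_vanish (R : realType) (a : nat -> R) (F : R -> R) m K :
  (forall t, (fun n => \sum_(0 <= k < n) a k * t ^+ k) @ \oo --> F t) ->
  (forall t, 0 < t <= 1 -> `|F t| <= K * t ^+ m) ->
  forall k, (k < m)%N -> a k = 0.
Proof.
move=> aF Fm.
(* Convergence at [t = 1] bounds all the coefficients. *)
have [M aM] : exists M, forall k : nat, `|a k| <= M.
  have a1 : cvgn (series a).
    apply/cvg_ex; exists (F 1).
    rewrite (_ : series a = (fun n => \sum_(0 <= k < n) a k * 1 ^+ k)).
      exact: aF.
    by apply/funext => n; apply: eq_bigr => k _; rewrite expr1n mulr1.
  have [M [_ HM]] := cvg_seq_bounded (cvgP _ (cvg_series_cvg_0 a1)).
  by exists (M + 1) => k; apply: HM => //; rewrite ltrDl.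
have M0 : 0 <= M := le_trans (normr_ge0 _) (aM 0%N).
have K0 : 0 <= K.
  by have := Fm 1; rewrite ltr01 lexx expr1n mulr1 => /(_ isT); apply: le_trans.
(* For [t <= 1/2] the geometric tail is at most twice its first term. *)
have tail j t : (forall i, (i < j)%N -> a i = 0) -> 0 < t <= 2^-1 ->
  `|F t - a j * t ^+ j| <= 2 * M * t ^+ j.+1.
  move=> aj /andP[t0 t2].
  apply: (cvgr_to_le (cvg_norm (cvgB (aF t) (cvg_cst (a j * t ^+ j))))).
  near=> n.
  have jn : (j < n)%N by near: n; exact: nbhs_infty_gt.
  rewrite -[leLHS]/(`|\sum_(0 <= k < n) a k * t ^+ k - a j * t ^+ j|).
  rewrite (big_cat_nat (n := j.+1)) //= big_nat_recr //=.
  rewrite big_nat big1 ?add0r => [|i ij]; last by rewrite aj ?mul0r.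
  rewrite addrAC subrr add0r (le_trans (ler_norm_sum _ _ _)) //.
  apply: (@le_trans _ _ (\sum_(j.+1 <= i < n) M * t ^+ i)).
    apply: ler_sum => i _.
    rewrite normrM (ger0_norm (exprn_ge0 _ (ltW t0))).
    by rewrite ler_wpM2r ?aM // exprn_ge0 // ltW.
  rewrite -mulr_sumr mulrAC mulrC ler_wpM2r //.
  rewrite -(subnKC jn) geometric_partial_tail.
  apply: le_trans (geometric_le_lim _ _ _ _) _ => //.
  - by rewrite exprn_ge0 // ltW.
  - by rewrite gtr0_norm //; lra.
  - by rewrite mulrC ler_wpM2r ?exprn_ge0 ?(ltW t0) // invf_ple ?posrE; lra.
move=> k; elim/ltn_ind: k => k IHk km.
have {}IHk i : (i < k)%N -> a i = 0.
  by move=> ik; apply: IHk => //; apply: ltn_trans km.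
have ak t : 0 < t <= 2^-1 -> `|a k| <= (K + 2 * M) * t.
  move=> t02; have /andP[t0 t2] := t02.
  have tk : 0 < t ^+ k by rewrite exprn_gt0.
  rewrite -(ler_pM2r tk) -mulrA -exprS mulrDl.
  have Ft : `|F t| <= K * t ^+ k.+1.
    apply: le_trans (Fm t _) _; first lra.
    by rewrite ler_wpM2l // ler_wiXn2l ?(ltW t0) //; lra.
  have := tail k t IHk t02; rewrite -{2}(gtr0_norm tk) -normrM => Ht.
  have -> : a k * t ^+ k = F t - (F t - a k * t ^+ k) by ring.
  by rewrite (le_trans (ler_normB _ _)) // lerD.
apply/eqP; apply: contraT => ak0; have {}ak0 : 0 < `|a k| by rewrite normr_gt0.
pose B := K + 2 * M; have B0 : 0 <= B by rewrite addr_ge0 // mulr_ge0.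
pose t := Num.min (2^-1) (`|a k| / (2 * (B + 1))).
have t0 : 0 < t by rewrite lt_min invr_gt0 ltr0n divr_gt0 // mulr_gt0 //; lra.
have t2 : t <= 2^-1 by rewrite ge_min lexx.
have tB : t * (2 * (B + 1)) <= `|a k|.
  by rewrite -ler_pdivlMr ?ge_min ?lexx ?orbT // mulr_gt0 //; lra.
have := ak t; rewrite t0 t2 => /(_ isT); rewrite -/B; nra.
Unshelve. all: by end_near.
Qed.

Lemma sin_le_id (R : realType) (x : R) : 0 <= x -> sin x <= x.
Proof.
rewrite le_eqVlt => /predU1P[<-|x0]; first by rewrite sin0.
have [|y _] := @MVT R (@sin R) (@cos R) 0 x x0 (fun y _ => is_derive_sin y).
  exact/continuous_subspaceT/continuous_sin.
by rewrite sin0 !subr0 => ->; rewrite ler_piMl ?cos_le1 ?ltW.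
Qed.

Lemma one_sub_cos_le (R : realType) (t : R) : 0 <= t <= 1 ->
  1 - cos t <= t ^+ 2 / 2.
Proof.
move=> /andP[t0 t1].
have -> : 1 - cos t = 2 * sin (t / 2) ^+ 2.
  by rewrite sin2cos2 [in LHS](splitr t) -mulr2n cos_mulr2n; ring.
have s1 : sin (t / 2) <= t / 2 by apply: sin_le_id; lra.
have s0 : 0 <= sin (t / 2).
  by apply: sin_ge0_pi; have := pi_ge2 R; lra.
by nra.
Qed.

Lemma horner_bounded (R : realType) (Q : {poly R}) :
  exists2 M, 0 <= M & forall x, -1 <= x <= 1 -> `|Q.[x]| <= M.
Proof.
exists (\sum_(i < size Q) `|Q`_i|); first by rewrite sumr_ge0.
move=> x x11; rewrite horner_coef (le_trans (ler_norm_sum _ _ _)) //.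
apply: ler_sum => i _; rewrite normrM ler_piMr // normrX exprn_ile1 //.
by rewrite ler_norml.
Qed.

Lemma cvg_Re (R : realType) (u : nat -> R[i]) (l : R[i]) :
  u @ \oo --> (l : R[i]^o) ->
  (fun n => complex.Re (u n)) @ \oo --> complex.Re l.
Proof.
move=> ucvg.
have ul : forall e : R[i], 0 < e -> \forall n \near \oo, `|l - u n| < e.
  exact/(@cvgrPdist_lt _ (R[i]^o) _ _ _ u l).
apply/cvgrPdist_lt => e e0.
have e0C : 0 < (e%:C)%C by rewrite ltcR.
have := ul _ e0C; apply: filterS => n Hn.
rewrite -ltcR; apply: le_lt_trans Hn.
apply: le_trans (normc_ge_Re _); rewrite lecR.
by case: (l) (u n) => [a b] [a' b'].
Qed.

(** Only the real part of the expansion is used, in which the term of degree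
four has coefficient [Re (i^4) C_4 = C_4]. *)
Lemma angular_coef4 (R : realType) J (c C : nat -> R) : (2 <= J)%N ->
  (stability_poly J c).[1] = 0 -> angular_expansion (delta_TTR J c) C ->
  C 4%N = 0.
Proof.
move=> J2 P1 CC.
set P := stability_poly J c in P1.
pose a k := if k == 0%N then 0 else complex.Re ('i%C ^+ k) * C k : R.
pose F t := (1 - cos t) ^+ 2 * P.[cos t].
have aF t : (fun n => \sum_(0 <= k < n) a k * t ^+ k) @ \oo --> F t.
  rewrite /F /P -Re_delta_TTR //.
  have := cvg_Re (CC t).
  rewrite (_ : (fun n => complex.Re _) =
    (fun n => \sum_(1 <= k < n) a k * t ^+ k)); last first.
    apply/funext => n; rewrite Re_sum !big_nat; apply: eq_bigr => k /andP[k1 _].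
    rewrite /a eqn0Ngt k1 /= -mulrA -rmorphXn -rmorphM /=.
    by rewrite mulrC Re_real_mul [LHS]mulrC mulrA.
  apply: cvg_trans; apply: near_eq_cvg; near=> n.
  have n0 : (0 < n)%N by near: n; exact: nbhs_infty_gt.
  by rewrite [RHS]big_ltn // /a /= mul0r add0r.
have /factor_theorem [Q PQ] : root P 1 by apply/eqP.
have [M M0 QM] := horner_bounded Q.
have FM t : 0 < t <= 1 -> `|F t| <= M * t ^+ 6.
  move=> t01; have cos1 : -1 <= cos t <= 1 by rewrite cos_geN1 cos_le1.
  have y2 : 1 - cos t <= t ^+ 2 / 2 by apply: one_sub_cos_le; lra.
  have -> : F t = - ((1 - cos t) ^+ 3 * Q.[cos t]).
    by rewrite /F PQ hornerM hornerXsubC; ring.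
  have y0 : 0 <= 1 - cos t by rewrite subr_ge0 cos_le1.
  have y3 : (1 - cos t) ^+ 3 <= t ^+ 6.
    rewrite (exprM t 2 3) lerXn2r ?nnegrE ?sqr_ge0 //.
    by have := sqr_ge0 t; lra.
  by rewrite normrN normrM mulrC ler_pM // ?QM // ger0_norm ?exprn_ge0.
have i4 : 'i%C ^+ 4 = 1 :> R[i].
  by rewrite (exprM 'i%C 2 2) sqr_i sqrrN expr1n.
have : complex.Re ('i%C ^+ 4) * C 4%N = 0.
  exact: (power_series_vanish aF FM (isT : (4 < 6)%N)).
by rewrite i4 mul1r.
Unshelve. all: by end_near.
Qed.

Theorem corollary3p4 (R : realType) (J : nat) (c : nat -> R)
    (hJ : (2 <= J)%N) (hc : optimal_TTR J c) :
  let c2 := c 2%N in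
  let c3 := if J == 2%N then 0 else c 3%N in
  c3 = 3 * c2 - 2 + (1 - (-1) ^+ J) / (J%:R + 1) * ((1 - c2) * (2 - c2))
  /\ (~~ odd J ->
      forall C : nat -> R, angular_expansion (delta_TTR J c) C -> C 4%N = 0).
Proof.
move=> c2 c3; split=> [|Jeven C]; last first.
  exact/angular_coef4/even_optimal.
have := stability_poly1 c hJ; rewrite -/c2 -/c3.
rewrite natr1 -signr_odd; have [Jodd|/negbTE Jeven] := boolP (odd J).
  have J0 : J.+1%:R != 0 :> R by rewrite pnatr_eq0.
  have := odd_optimal hJ hc Jodd; rewrite -/c2.
  by move=> <- ->; rewrite expr1; field.
by rewrite even_optimal // ?Jeven //= expr0 subrr mul0r mul0r; lra.
Qed.
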